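(* Let $\varphi$ be a holomorphic self-map of the unit disk $\mathbb{D}$ with $\varphi(0)=0$ and $0<|\varphi'(0)|<1$, let $\sigma$ be the Königs function of $\varphi$, and let $\alpha>1$. If $$\frac{(1-|z|^2)\,|\varphi'(z)|}{1-|\varphi(z)|^2}\le|\varphi'(0)|\qquad\text{for all } z\in\mathbb{D},$$ then the composition operator $C_\varphi$ is bounded on $\mathcal{B}_\alpha$, and $\sigma^n\in\mathcal{B}_\alpha$ for all positive integers $n$.
   Context: $\mathbb{D}$ is the open unit disk in the complex plane. For $\alpha>0$, the Bloch-type space $\mathcal{B}_\alpha$ is the set of holomorphic $f$ on $\mathbb{D}$ with $\sup_{z\in\mathbb{D}}(1-|z|^2)^\alpha|f'(z)|<\infty$; it is a Banach space under the norm $\|f\|_{\mathcal{B}_\alpha}=|f(0)|+\sup_{z\in\mathbb{D}}(1-|z|^2)^\alpha|f'(z)|$. The composition operator is $C_\varphi f=f\circ\varphi$. $\varphi_k$ denotes the $k$-th iterate of $\varphi$. When $\varphi(0)=0$ and $0<|\varphi'(0)|<1$, the Königs function $\sigma$ of $\varphi$ is the holomorphic function $\sigma=\lim_{k\to\infty}\varphi_k/\varphi'(0)^k$ (the limit exists uniformly on compact subsets of $\mathbb{D}$ by Königs's theorem); it satisfies $\sigma\circ\varphi=\varphi'(0)\sigma$. $\sigma^n$ denotes the $n$-th pointwise power of $\sigma$. *)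

(* Defs.v *)
From Stdlib Require Import Reals.
From Coquelicot Require Import Coquelicot.

Local Open Scope R_scope.

Definition disk (z : C) : Prop := Cmod z < 1.

(* A function on the disk is represented by a total function [C -> C]; its
   values outside the open disk are never used.  As the disk is open,
   [C_derive f z] is the complex derivative at [z] whenever [f] is
   holomorphic on the disk and [disk z]. *)
Definition holomorphic_on_disk (f : C -> C) : Prop :=
  forall z : C, disk z -> @ex_derive C_AbsRing C_NormedModule f z.

Definition disk_self_map (phi : C -> C) : Prop :=
  holomorphic_on_disk phi /\ forall z : C, disk z -> disk (phi z).

(* [Rpower] has its intended meaning only for a positive base, which
   [1 - Cmod z ^ 2] is on the disk. *)
Definition bloch_values (alpha : R) (f : C -> C) (y : R) : Prop :=
  exists z : C, disk z /\
    y = Rpower (1 - Cmod z ^ 2) alpha * Cmod (C_derive f z).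

Definition bloch (alpha : R) (f : C -> C) : Prop :=
  holomorphic_on_disk f /\ Rbar_lt (Lub_Rbar (bloch_values alpha f)) p_infty.

(* The supremum lies in the extended reals; on [bloch alpha] it is finite, so
   the projection [real] loses nothing there. *)
Definition bloch_norm (alpha : R) (f : C -> C) : R :=
  Cmod (f (RtoC 0)) + real (Lub_Rbar (bloch_values alpha f)).

Definition bounded_on_bloch (alpha : R) (T : (C -> C) -> (C -> C)) : Prop :=
  (forall f : C -> C, bloch alpha f -> bloch alpha (T f)) /\
  exists M : R, forall f : C -> C,
    bloch alpha f -> bloch_norm alpha (T f) <= M * bloch_norm alpha f.

Definition comp_op (phi f : C -> C) : C -> C := fun z => f (phi z).

(* The pointwise limit determines [sigma] on the disk, so this characterizes
   the Koenigs function uniquely there; locally uniform convergence is a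
   theorem about it and is not built into the definition. *)
Definition is_koenigs (phi sigma : C -> C) : Prop :=
  holomorphic_on_disk sigma /\
  forall z : C, disk z ->
    filterlim
      (fun k : nat =>
         (Nat.iter k phi z / C_derive phi (RtoC 0) ^ k)%C)
      eventually (@locally C_UniformSpace (sigma z)).

(* Main.v *)
(* Write c = |phi'(0)|. The hypothesis says that phi contracts the hyperbolic
   metric by the factor c. Integrating along radii gives
   artanh |phi(z)| <= c artanh |z|, hence |phi(z)| <= |z|, and boundedness of
   C_phi follows from alpha >= 1. The k-th iterate phi_k contracts by c^k, so
   |phi_k(z)| / c^k <= artanh |z| and |phi_k'(z)| / c^k <= 1 / (1 - |z|^2).
   The first bound passes to sigma; the second passes to sigma as a local
   Lipschitz bound, and thus to sigma' without Cauchy's formula, at the price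
   of the factor 4. Finally (1 - r^2)^(alpha - 1) (artanh r)^(n - 1) is bounded
   on [0, 1) because artanh grows logarithmically. *)

Require Import Defs.
From Stdlib Require Import Reals Lra.
From Coquelicot Require Import Coquelicot.
Local Open Scope R_scope.

(** * Complex derivatives and mean value estimates *)

Lemma is_C_derive_eps (f : C -> C) (z l : C) :
  @is_derive C_AbsRing C_NormedModule f z l ->
  forall eps : R, 0 < eps -> exists delta : R, 0 < delta /\
    forall y : C, Cmod (y - z) < delta ->
      Cmod (f y - f z - (y - z) * l)%C <= eps * Cmod (y - z).
Proof.
intros [_ Hd] eps Heps.
destruct (Hd z (fun P HP => HP) (mkposreal eps Heps)) as [d Hdel].
exists d; split; [apply cond_pos|].
intros y Hy; exact (Hdel y Hy).
Qed.

(** The bridge from complex to real calculus: the chain rule along a real line, read off the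
    remainder estimate of [f]. *)
Lemma is_derive_Re_line (f : C -> C) (u z v l : C) (t0 : R) :
  @is_derive C_AbsRing C_NormedModule f (z + RtoC t0 * v)%C l ->
  is_derive (fun t : R => Re (u * f (z + RtoC t * v))%C) t0
    (Re (u * (l * v))%C).
Proof.
intros Hf; apply is_derive_Reals; intros eps Heps.
(* The remainder gets multiplied by [k]. Dividing [eps] by [k + 1] covers [k = 0] and keeps the
   final inequality strict. *)
set (k := Cmod u * Cmod v).
assert (Hk : 0 <= k) by (apply Rmult_le_pos; apply Cmod_ge_0).
assert (He' : 0 < eps / (k + 1)) by (apply Rdiv_lt_0_compat; lra).
destruct (is_C_derive_eps _ _ _ Hf _ He') as [d [Hd Hdel]].
assert (Hv : 0 < Cmod v + 1) by (generalize (Cmod_ge_0 v); lra).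
assert (Hd' : 0 < d / (Cmod v + 1)) by (apply Rdiv_lt_0_compat; lra).
exists (mkposreal _ Hd'); intros h Hh Hhd.
change (Rabs h < d / (Cmod v + 1)) in Hhd.
assert (Habs : 0 < Rabs h) by now apply Rabs_pos_lt.
set (y := (z + RtoC (t0 + h) * v)%C).
assert (Ey : (y - (z + RtoC t0 * v))%C = (RtoC h * v)%C).
{ unfold y; rewrite RtoC_plus; ring. }
specialize (Hdel y); rewrite Ey, Cmod_mult, Cmod_R in Hdel.
assert (Hy : Rabs h * Cmod v < d).
{ apply Rmult_lt_compat_r with (r := Cmod v + 1) in Hhd; [|lra].
  replace (d / (Cmod v + 1) * (Cmod v + 1)) with d in Hhd by (field; lra).
  lra. }
specialize (Hdel Hy).
set (e := (f y - f (z + RtoC t0 * v) - RtoC h * v * l)%C) in Hdel.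
assert (E : Re (u * f y)%C - Re (u * f (z + RtoC t0 * v))%C
            - h * Re (u * (l * v))%C = Re (u * e)%C).
{ rewrite <- re_scal_l; unfold Rminus; rewrite <- !re_opp, <- !re_plus.
  f_equal; unfold e; ring. }
replace ((Re (u * f y)%C - Re (u * f (z + RtoC t0 * v))%C) / h
          - Re (u * (l * v))%C) with (Re (u * e)%C / h)
  by (rewrite <- E; field; assumption).
rewrite Rabs_div by assumption; apply Rlt_div_l; [assumption|].
apply Rle_lt_trans with (1 := re_le_Cmod _); rewrite Cmod_mult.
apply Rle_lt_trans with (eps / (k + 1) * k * Rabs h).
- replace (eps / (k + 1) * k * Rabs h)
    with (Cmod u * (eps / (k + 1) * (Rabs h * Cmod v)))
    by (unfold k; ring).
  now apply Rmult_le_compat_l; [apply Cmod_ge_0|].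
- apply Rmult_lt_compat_r; [assumption|].
  apply Rmult_lt_reg_r with (k + 1); [lra|].
  replace (eps / (k + 1) * k * (k + 1)) with (eps * k) by (field; lra).
  apply Rmult_lt_compat_l; lra.
Qed.

(** The mean value theorem for [g - f]; it takes the place of integrating an inequality. *)
Lemma derive_le_increment_le (f g df dg : R -> R) :
  (forall t, 0 <= t <= 1 -> is_derive f t (df t)) ->
  (forall t, 0 <= t <= 1 -> is_derive g t (dg t)) ->
  (forall t, 0 <= t <= 1 -> df t <= dg t) ->
  f 1 - f 0 <= g 1 - g 0.
Proof.
intros Hf Hg Hle.
assert (Hd : forall t, 0 <= t <= 1 ->
   is_derive (fun t => g t - f t) t (dg t - df t)).
{ intros t Ht; apply (is_derive_minus g f); [now apply Hg|now apply Hf]. }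
destruct (MVT_gen (fun t => g t - f t) 0 1 (fun t => dg t - df t))
  as [t [Ht E]]; rewrite ?Rmin_left, ?Rmax_right in * by lra.
- intros x Hx; apply Hd; lra.
- intros x Hx; apply derivable_continuous_pt.
  exists (dg x - df x); apply is_derive_Reals, Hd; lra.
- generalize (Hle t Ht); lra.
Qed.

(* A phase [u] turns modulus estimates for a complex function along a segment
   into estimates for the differentiable real function [Re (u * f)]. *)
Lemma exists_phase (w : C) :
  exists u : C, Cmod u <= 1 /\ Re (u * w)%C = Cmod w.
Proof.
destruct (Req_dec (Cmod w) 0) as [H0|H0].
- exists (RtoC 0); rewrite Cmod_0; split; [lra|].
  rewrite Cmult_0_l, H0; reflexivity.
- assert (Hw : RtoC (Cmod w) <> RtoC 0) by (intros H; apply H0, RtoC_inj, H).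
  exists (Cconj w / RtoC (Cmod w))%C; split.
  + rewrite Cmod_div, Cmod_conj, Cmod_R, Rabs_pos_eq by
      (trivial; apply Cmod_ge_0).
    right; field; assumption.
  + replace (Cconj w / RtoC (Cmod w) * w)%C
      with (w * Cconj w / RtoC (Cmod w))%C by (field; assumption).
    rewrite <- Cmod2_conj, <- RtoC_div by assumption.
    rewrite re_RtoC; field; assumption.
Qed.

Lemma Re_phase_le (u w : C) : Cmod u <= 1 -> Rabs (Re (u * w)%C) <= Cmod w.
Proof.
intros Hu; apply Rle_trans with (1 := re_le_Cmod _); rewrite Cmod_mult.
generalize (Rmult_le_compat_r _ _ _ (Cmod_ge_0 w) Hu); lra.
Qed.

(** The segment from [a] to [b] stays in the closed disk by convexity. With the phase of
    [f b - f a], the real function [Re (u * f)] grows along it by exactly the modulus to be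
    bounded. *)
Lemma Cmod_increment_le (f : C -> C) (a b : C) (r M : R) :
  (forall z, Cmod z <= r -> @ex_derive C_AbsRing C_NormedModule f z) ->
  (forall z, Cmod z <= r -> Cmod (C_derive f z) <= M) ->
  Cmod a <= r -> Cmod b <= r ->
  Cmod (f b - f a)%C <= M * Cmod (b - a)%C.
Proof.
intros Hf HM Ha Hb.
destruct (exists_phase (f b - f a)%C) as [u [Hu Eu]].
set (p := fun t : R => (a + RtoC t * (b - a))%C).
assert (Hp : forall t, 0 <= t <= 1 -> Cmod (p t) <= r).
{ intros t Ht.
  replace (p t) with (RtoC (1 - t) * a + RtoC t * b)%C
    by (unfold p; rewrite RtoC_minus; ring).
  apply Rle_trans with (1 := Cmod_triangle _ _).
  rewrite !Cmod_mult, !Cmod_R, !Rabs_pos_eq by lra.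
  generalize (Rmult_le_compat_l (1 - t) _ _ ltac:(lra) Ha)
    (Rmult_le_compat_l t _ _ ltac:(lra) Hb); lra. }
assert (H := derive_le_increment_le
  (fun t => Re (u * f (p t))%C) (fun t => t * (M * Cmod (b - a)))
  (fun t => Re (u * (C_derive f (p t) * (b - a)))%C)
  (fun _ => M * Cmod (b - a))).
cbv beta in H; replace (p 1) with b in H by (unfold p; ring).
replace (p 0) with a in H by (unfold p; ring).
replace (Cmod (f b - f a)) with (Re (u * f b)%C - Re (u * f a)%C).
2: { rewrite <- Eu; unfold Rminus; rewrite <- re_opp, <- re_plus.
     f_equal; ring. }
replace (M * Cmod (b - a)) with
  (1 * (M * Cmod (b - a)) - 0 * (M * Cmod (b - a))) by ring.
apply H; clear H; intros t Ht.
- apply is_derive_Re_line, C_derive_correct; [exact (RtoC 0)|].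
  apply Hf, (Hp t Ht).
- auto_derive; trivial; ring.
- apply Rle_trans with (1 := Rle_abs _).
  apply Rle_trans with (1 := Re_phase_le _ _ Hu).
  rewrite Cmod_mult; apply Rmult_le_compat_r; [apply Cmod_ge_0|].
  apply HM, Hp, Ht.
Qed.

(** A converse to the mean value inequality. Lipschitz bounds survive pointwise limits, so this
    carries derivative bounds to a limit function. *)
Lemma Cmod_C_derive_le (f : C -> C) (z : C) (M d : R) :
  0 < d -> @ex_derive C_AbsRing C_NormedModule f z ->
  (forall y, Cmod (y - z)%C < d -> Cmod (f y - f z)%C <= M * Cmod (y - z)%C) ->
  Cmod (C_derive f z) <= M.
Proof.
intros Hd Hf HM.
apply le_epsilon; intros eps Heps.
destruct (is_C_derive_eps _ _ _ (C_derive_correct f z z Hf) eps Heps)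
  as [d' [Hd' H]].
(* One real step, inside both the Lipschitz radius and the differentiability radius, suffices. *)
set (h := Rmin d d' / 2).
assert (Hh : 0 < h /\ h < d /\ h < d').
{ unfold h; generalize (Rmin_l d d') (Rmin_r d d') (Rmin_pos d d' Hd Hd'); lra. }
set (y := (z + RtoC h)%C).
assert (Ey : (y - z)%C = RtoC h) by (unfold y; ring).
specialize (H y); specialize (HM y).
rewrite Ey, Cmod_R, Rabs_pos_eq in H, HM by lra.
specialize (H ltac:(lra)); specialize (HM ltac:(lra)).
apply Rmult_le_reg_l with h; [lra|].
replace (h * Cmod (C_derive f z)) with (Cmod (RtoC h * C_derive f z)%C)
  by (rewrite Cmod_mult, Cmod_R, Rabs_pos_eq; lra).
replace (RtoC h * C_derive f z)%C with
  ((f y - f z) + - (f y - f z - RtoC h * C_derive f z))%C by ring.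
apply Rle_trans with (1 := Cmod_triangle _ _); rewrite Cmod_opp; lra.
Qed.

Lemma Cmod_lim_le (u : nat -> C) (l : C) (B : R) :
  filterlim u eventually (@locally C_UniformSpace l) ->
  (forall k, Cmod (u k) <= B) -> Cmod l <= B.
Proof.
intros Hu HB.
apply (filterlim_le (F := eventually) (fun k => Cmod (u k)) (fun _ => B)
  (Finite (Cmod l)) (Finite B)).
- now apply filter_forall.
- rewrite Cmod_norm.
  apply (filterlim_ext (fun k => @norm _ C_R_NormedModule (u k))).
  { intros k; symmetry; apply Cmod_norm. }
  exact (filterlim_comp _ _ _ _ _ _ _ _ Hu
    (@filterlim_norm _ C_R_NormedModule l)).
- apply filterlim_const.
Qed.

(** * The function artanh and its logarithmic growth *)

(** For 0 <= x < 1 this is the distance from 0 to a point of modulus x in the metric |dz| / (1 -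
    |z|^2). *)
Definition artanh (x : R) : R := (ln (1 + x) - ln (1 - x)) / 2.

Lemma artanh_0 : artanh 0 = 0.
Proof. unfold artanh; rewrite Rplus_0_r, Rminus_0_r; lra. Qed.

Lemma is_derive_artanh (x : R) :
  -1 < x < 1 -> is_derive artanh x (/ (1 - x ^ 2)).
Proof.
intros Hx; unfold artanh; auto_derive; [lra|].
field; repeat split; nra.
Qed.

(** The derivative 1 / (1 - x^2) is at least 1 on [0, 1). *)
Lemma artanh_increment_ge (x y : R) :
  0 <= x -> x <= y -> y < 1 -> y - x <= artanh y - artanh x.
Proof.
intros Hx Hxy Hy.
assert (H := derive_le_increment_le (fun t => t * (y - x))
  (fun t => artanh (x + t * (y - x)))
  (fun _ => y - x) (fun t => (y - x) * / (1 - (x + t * (y - x)) ^ 2))).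
cbv beta in H.
replace (x + 1 * (y - x)) with y in H by ring.
replace (x + 0 * (y - x)) with x in H by ring.
replace (y - x) with (1 * (y - x) - 0 * (y - x)) at 1 by ring.
apply H; intros t Ht.
- auto_derive; trivial; ring.
- apply (is_derive_comp artanh (fun t => x + t * (y - x))).
  + apply is_derive_artanh; nra.
  + auto_derive; trivial; ring.
- assert (Hq : 0 <= x + t * (y - x) < 1) by nra.
  set (q := x + t * (y - x)) in *.
  rewrite <- (Rmult_1_r (y - x)) at 1.
  apply Rmult_le_compat_l; [lra|].
  rewrite <- Rinv_1 at 1; apply Rinv_le_contravar; nra.
Qed.

Lemma le_artanh (x : R) : 0 <= x < 1 -> x <= artanh x.
Proof.
intros Hx; generalize (artanh_increment_ge 0 x); rewrite artanh_0; lra.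
Qed.

Lemma artanh_le_inv (x y : R) :
  0 <= x < 1 -> 0 <= y -> artanh x <= artanh y -> x <= y.
Proof.
intros Hx Hy H; destruct (Rle_lt_dec x y) as [|Hlt]; [assumption|].
generalize (artanh_increment_ge y x); lra.
Qed.

(** Indeed artanh x = ln (1 + x) - ln (1 - x^2) / 2, and ln (1 + x) <= x < 1. *)
Lemma artanh_le_ln (x : R) :
  0 <= x < 1 -> artanh x <= 1 - ln (1 - x ^ 2) / 2.
Proof.
intros Hx; unfold artanh.
replace (1 - x ^ 2) with ((1 + x) * (1 - x)) by ring.
rewrite ln_mult by lra.
assert (ln (1 + x) <= x).
{ rewrite <- (ln_exp x) at 2; apply ln_le; [lra|apply exp_ineq1_le]. }
lra.
Qed.

(** Split the power [e] into [m + 1] equal powers [d]: each of [m] of them absorbs one factor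
    artanh, and the last is at most 1. *)
Lemma Rpower_artanh_pow_bounded (e : R) (m : nat) : 0 < e ->
  exists K : R, forall x : R, 0 <= x < 1 ->
    Rpower (1 - x ^ 2) e * artanh x ^ m <= K.
Proof.
intros He.
set (d := e / INR (S m)).
assert (Hm : 0 < INR (S m)) by apply lt_0_INR, Nat.lt_0_succ.
assert (Hd : 0 < d) by now apply Rdiv_lt_0_compat.
exists ((1 + / (2 * d)) ^ m); intros x Hx.
assert (Hs : 0 < 1 - x ^ 2 <= 1) by nra.
set (p := Rpower (1 - x ^ 2) d).
assert (Hp0 : 0 < p) by apply exp_pos.
assert (Ep : Rpower (1 - x ^ 2) e = p ^ S m).
{ rewrite <- (Rpower_pow (S m) p Hp0); unfold p; rewrite Rpower_mult.
  f_equal; unfold d; field; lra. }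
set (w := - ln (1 - x ^ 2)).
assert (Hw : 0 <= w).
{ unfold w; generalize (ln_le _ _ (proj1 Hs) (proj2 Hs)); rewrite ln_1; lra. }
(* Since p = exp (- d w), the inequality 1 + d w <= exp (d w) bounds both p and p d w by 1. *)
assert (Hpw : p * (1 + d * w) <= 1).
{ apply Rle_trans with (p * exp (d * w)).
  - apply Rmult_le_compat_l; [lra|apply exp_ineq1_le].
  - unfold p, Rpower; rewrite <- exp_plus; right.
    replace (d * ln (1 - x ^ 2) + d * w) with 0 by (unfold w; ring).
    exact exp_0. }
assert (Hp1 : p <= 1) by (assert (0 <= d * w) by nra; nra).
assert (HA0 : 0 <= artanh x) by (generalize (le_artanh x Hx); lra).
assert (HA : p * artanh x <= 1 + / (2 * d)).
{ apply Rle_trans with (p * (1 + w / 2)).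
  - apply Rmult_le_compat_l; [lra|].
    generalize (artanh_le_ln x Hx); unfold w; lra.
  - replace (p * (1 + w / 2)) with (p + p * (d * w) * / (2 * d))
      by (field; lra).
    assert (0 < / (2 * d)) by (apply Rinv_0_lt_compat; lra).
    assert (p * (d * w) * / (2 * d) <= 1 * / (2 * d))
      by (apply Rmult_le_compat_r; lra).
    lra. }
rewrite Ep; replace (p ^ S m * artanh x ^ m) with (p * (p * artanh x) ^ m)
  by (rewrite Rpow_mult_distr; simpl; ring).
assert (H0 : 0 <= p * artanh x) by nra.
apply Rle_trans with (1 * (p * artanh x) ^ m).
- apply Rmult_le_compat_r; [now apply pow_le|assumption].
- rewrite Rmult_1_l; apply pow_incr; lra.
Qed.

(** * Hyperbolic contractions fixing the origin *)

Lemma one_minus_sqr_Cmod (z : C) : disk z -> 0 < 1 - Cmod z ^ 2 <= 1.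
Proof. unfold disk; intros Hz; generalize (Cmod_ge_0 z); nra. Qed.

(** Contraction of the metric |dz| / (1 - |z|^2) by the factor [c], in division-free form. Bundled
    with the self-map and fixed-point conditions, it is stable under composition and so applies to
    iterates. *)
Definition hyperbolic_contraction (c : R) (f : C -> C) : Prop :=
  disk_self_map f /\ f (RtoC 0) = RtoC 0 /\
  forall z, disk z ->
    (1 - Cmod z ^ 2) * Cmod (C_derive f z) <= c * (1 - Cmod (f z) ^ 2).

Lemma hyperbolic_contraction_artanh (c : R) (f : C -> C) (z : C) :
  0 <= c -> hyperbolic_contraction c f -> disk z ->
  artanh (Cmod (f z)) <= c * artanh (Cmod z).
Proof.
intros Hc [[Hhol Hself] [H0 Hf]] Hz.
(* The phase is chosen at the endpoint: [h 1] is [Cmod (f z)], while [Rabs (h t)] is at most the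
   modulus of [f] elsewhere on the radius. *)
destruct (exists_phase (f z)) as [u [Hu Eu]].
set (h := fun t : R => Re (u * f (RtoC 0 + RtoC t * z))%C).
assert (Hmod : forall t, 0 <= t <= 1 ->
  Cmod (RtoC 0 + RtoC t * z)%C = t * Cmod z).
{ intros t Ht; rewrite Cplus_0_l, Cmod_mult, Cmod_R, Rabs_pos_eq; lra. }
assert (Hr := Cmod_ge_0 z); unfold disk in Hz.
assert (Hray : forall t, 0 <= t <= 1 -> disk (RtoC 0 + RtoC t * z)%C).
{ intros t Ht; unfold disk; rewrite Hmod by assumption; nra. }
assert (Htz : forall t, 0 <= t <= 1 -> 0 <= t * Cmod z < 1).
{ intros t Ht; rewrite <- Hmod by assumption.
  split; [apply Cmod_ge_0|now apply Hray]. }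
assert (Hh : forall t, 0 <= t <= 1 ->
  Rabs (h t) <= Cmod (f (RtoC 0 + RtoC t * z)%C) /\
  Cmod (f (RtoC 0 + RtoC t * z)%C) < 1).
{ intros t Ht; split; [now apply Re_phase_le|now apply Hself, Hray]. }
assert (H := derive_le_increment_le (fun t => artanh (h t))
  (fun t => c * artanh (t * Cmod z))
  (fun t => Re (u * (C_derive f (RtoC 0 + RtoC t * z) * z))%C
            * / (1 - h t ^ 2))
  (fun t => c * (Cmod z * / (1 - (t * Cmod z) ^ 2)))).
cbv beta in H.
replace (h 1) with (Cmod (f z)) in H.
2: { unfold h; rewrite Cplus_0_l, Cmult_1_l; now rewrite Eu. }
replace (h 0) with 0 in H.
2: { unfold h; rewrite Cplus_0_l, Cmult_0_l, H0, Cmult_0_r; reflexivity. }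
rewrite Rmult_0_l, Rmult_1_l, artanh_0, Rmult_0_r, !Rminus_0_r in H.
apply H; clear H; intros t Ht; destruct (Hh t Ht) as [Hh1 Hh2];
  specialize (Htz t Ht).
- apply (is_derive_comp artanh h).
  + apply is_derive_artanh; split_Rabs; lra.
  + apply is_derive_Re_line, C_derive_correct; [exact (RtoC 0)|].
    now apply Hhol, Hray.
- apply is_derive_scal.
  apply (is_derive_comp artanh (fun t => t * Cmod z)).
  + apply is_derive_artanh; lra.
  + auto_derive; trivial; ring.
- specialize (Hf _ (Hray t Ht)); rewrite Hmod in Hf by assumption.
  set (w := (RtoC 0 + RtoC t * z)%C) in *.
  assert (Hs : 0 < 1 - (t * Cmod z) ^ 2) by nra.
  (* Passing from |f w| to the smaller |h t| enlarges the denominator of the derivative of artanh (h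
     t), which is the direction needed. *)
  assert (Hq : 1 - Cmod (f w) ^ 2 <= 1 - h t ^ 2).
  { rewrite <- (pow2_abs (h t)); generalize (Rabs_pos (h t)); nra. }
  assert (Hk : 0 < 1 - h t ^ 2).
  { generalize (Cmod_ge_0 (f w)); nra. }
  assert (HD : Re (u * (C_derive f w * z))%C <= Cmod (C_derive f w) * Cmod z).
  { rewrite <- Cmod_mult; apply Rle_trans with (1 := Rle_abs _).
    now apply Re_phase_le. }
  apply (Rle_div_l _ _ _ Hk).
  apply Rle_trans with (1 := HD).
  apply Rmult_le_reg_l with (1 := Hs).
  replace ((1 - (t * Cmod z) ^ 2) *
    (c * (Cmod z * / (1 - (t * Cmod z) ^ 2)) * (1 - h t ^ 2)))
    with (c * (1 - h t ^ 2) * Cmod z) by (field; lra).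
  rewrite <- Rmult_assoc; apply Rmult_le_compat_r; [assumption|].
  apply Rle_trans with (1 := Hf); now apply Rmult_le_compat_l.
Qed.

(** The Schwarz lemma estimate, obtained from the monotonicity of artanh. *)
Lemma hyperbolic_contraction_Cmod_le (c : R) (f : C -> C) (z : C) :
  0 <= c <= 1 -> hyperbolic_contraction c f -> disk z -> Cmod (f z) <= Cmod z.
Proof.
intros Hc Hf Hz.
assert (Hr := Cmod_ge_0 z).
apply artanh_le_inv; [|assumption|].
- split; [apply Cmod_ge_0|]; destruct Hf as [[_ Hs] _]; exact (Hs z Hz).
- apply Rle_trans with (1 := hyperbolic_contraction_artanh c f z (proj1 Hc) Hf Hz).
  generalize (le_artanh (Cmod z) (conj Hr Hz)); nra.
Qed.

(** * Chain rule, power rule and iterates *)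

(* Coquelicot gives [C] two normed-module structures over itself, with the same
   norm but different uniform structures; [C_derive] uses the first, the chain
   and product rules the second. *)
Lemma is_C_derive_AbsRing (f : C -> C) (z l : C) :
  @is_derive C_AbsRing C_NormedModule f z l <->
  @is_derive C_AbsRing (AbsRing_NormedModule C_AbsRing) f z l.
Proof.
split; intros [_ H]; (split; [apply is_linear_scal_l|exact H]).
Qed.

Lemma is_C_derive_comp (f g : C -> C) (z : C) :
  @ex_derive C_AbsRing C_NormedModule f (g z) ->
  @ex_derive C_AbsRing C_NormedModule g z ->
  @is_derive C_AbsRing C_NormedModule (fun w => f (g w)) z
    (C_derive g z * C_derive f (g z))%C.
Proof.
intros Hf Hg.
apply (@is_derive_comp C_AbsRing C_NormedModule f g).
- apply C_derive_correct; trivial.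
- apply is_C_derive_AbsRing, C_derive_correct; trivial.
Qed.

Lemma is_C_derive_pow (f : C -> C) (z l : C) (n : nat) :
  @is_derive C_AbsRing C_NormedModule f z l ->
  @is_derive C_AbsRing C_NormedModule (fun w => f w ^ n)%C z
    (RtoC (INR n) * f z ^ pred n * l)%C.
Proof.
intros Hf; apply is_C_derive_AbsRing in Hf; apply is_C_derive_AbsRing.
induction n as [|n IH].
- replace (RtoC (INR 0) * f z ^ pred 0 * l)%C with (RtoC 0)
    by (simpl; ring).
  exact (@is_derive_const C_AbsRing (AbsRing_NormedModule C_AbsRing)
    (RtoC 1) z).
- assert (H := @is_derive_mult C_AbsRing f (fun w => f w ^ n)%C z l _
     Hf IH Cmult_comm).
  replace (RtoC (INR (S n)) * f z ^ pred (S n) * l)%C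
    with (l * f z ^ n + f z * (RtoC (INR n) * f z ^ pred n * l))%C.
  + exact H.
  (* For n = 0 the truncated [pred] breaks f^n = f * f^(n-1), but the coefficient [INR 0] kills that
     term. *)
  + rewrite S_INR, RtoC_plus; destruct n as [|n]; simpl pred.
    * simpl; ring.
    * rewrite Cpow_S; ring.
Qed.

Lemma hyperbolic_contraction_id : hyperbolic_contraction 1 (fun z => z).
Proof.
assert (Hd : forall z : C, @is_derive C_AbsRing C_NormedModule (fun z => z) z
  (RtoC 1)) by
  (intros z; apply is_C_derive_AbsRing, (@is_derive_id C_AbsRing)).
split; [split; [intros z _; exists (RtoC 1); apply Hd|trivial]|].
split; [reflexivity|]; intros z _.
rewrite (is_C_derive_unique (fun w : C => w) z _ (Hd z)), Cmod_1; lra.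
Qed.

(** In the chain rule the factor 1 - |g z|^2 links the two estimates, so the constants multiply. *)
Lemma hyperbolic_contraction_comp (c d : R) (f g : C -> C) :
  0 <= c ->
  hyperbolic_contraction c f -> hyperbolic_contraction d g ->
  hyperbolic_contraction (c * d) (fun z => f (g z)).
Proof.
intros Hc [[Hfh Hfs] [Hf0 Hf]] [[Hgh Hgs] [Hg0 Hg]].
assert (Hd := fun z (Hz : disk z) =>
  is_C_derive_comp f g z (Hfh _ (Hgs z Hz)) (Hgh z Hz)).
split; [split|split].
- intros z Hz; eexists; exact (Hd z Hz).
- intros z Hz; apply Hfs, Hgs, Hz.
- now rewrite Hg0.
- intros z Hz; rewrite (is_C_derive_unique (fun w : C => f (g w)) z _ (Hd z Hz)), Cmod_mult.
  specialize (Hg z Hz); specialize (Hf _ (Hgs z Hz)).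
  rewrite <- Rmult_assoc.
  apply Rle_trans with (d * (1 - Cmod (g z) ^ 2) * Cmod (C_derive f (g z))).
  + apply Rmult_le_compat_r; [apply Cmod_ge_0|assumption].
  + assert (0 <= d).
    { apply Rmult_le_reg_r with (1 - Cmod (g z) ^ 2).
      - apply one_minus_sqr_Cmod, Hgs, Hz.
      - rewrite Rmult_0_l; apply Rle_trans with (2 := Hg).
        apply Rmult_le_pos; [|apply Cmod_ge_0].
        apply Rlt_le, one_minus_sqr_Cmod, Hz. }
    generalize (Rmult_le_compat_l d _ _ ltac:(lra) Hf); lra.
Qed.

Lemma hyperbolic_contraction_iter (c : R) (f : C -> C) (k : nat) :
  0 <= c -> hyperbolic_contraction c f ->
  hyperbolic_contraction (c ^ k) (Nat.iter k f).
Proof.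
intros Hc Hf; induction k as [|k IH].
- exact hyperbolic_contraction_id.
- exact (hyperbolic_contraction_comp c (c ^ k) f (Nat.iter k f) Hc Hf IH).
Qed.

(** * Growth of the Koenigs function and of its derivative *)

Lemma filterlim_Cminus (u v : nat -> C) (l m : C) :
  filterlim u eventually (@locally C_UniformSpace l) ->
  filterlim v eventually (@locally C_UniformSpace m) ->
  filterlim (fun k => (u k - v k)%C) eventually
    (@locally C_UniformSpace (l - m)%C).
Proof.
intros Hu Hv.
apply (filterlim_comp_2 (F := eventually) u (fun k => (- v k)%C) Cplus
  (G := @locally C_UniformSpace l) (H := @locally C_UniformSpace (- m)%C)).
- exact Hu.
- exact (filterlim_comp _ _ _ v Copp eventually _ _ Hv
    (@filterlim_opp _ C_R_NormedModule m)).
- exact (@filterlim_plus _ C_R_NormedModule l (- m)%C).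
Qed.

Lemma Cmod_div_pow (w l : C) (k : nat) :
  0 < Cmod l -> Cmod (w / l ^ k)%C = Cmod w / Cmod l ^ k.
Proof.
intros Hl; now rewrite Cmod_div, Cmod_pow by (apply Cpow_nz, Cmod_gt_0, Hl).
Qed.

(** Every approximant obeys the bound, as x <= artanh x and the k-th iterate contracts by
    |lambda|^k. *)
Lemma koenigs_Cmod_le (phi sigma : C -> C) (z : C) :
  0 < Cmod (C_derive phi (RtoC 0)) ->
  hyperbolic_contraction (Cmod (C_derive phi (RtoC 0))) phi ->
  is_koenigs phi sigma -> disk z ->
  Cmod (sigma z) <= artanh (Cmod z).
Proof.
set (lambda := C_derive phi (RtoC 0)); intros Hder0 Hphi Hsigma Hz.
apply (Cmod_lim_le _ _ _ (proj2 Hsigma z Hz)); intros k.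
assert (Hk := hyperbolic_contraction_iter _ _ k (Rlt_le _ _ Hder0) Hphi).
fold lambda; assert (Hc : 0 < Cmod lambda ^ k) by now apply pow_lt.
rewrite Cmod_div_pow by assumption; apply Rle_div_l; [assumption|].
rewrite Rmult_comm.
apply Rle_trans with (artanh (Cmod (Nat.iter k phi z))).
- apply le_artanh; split; [apply Cmod_ge_0|].
  exact (proj2 (proj1 Hk) z Hz).
- apply hyperbolic_contraction_artanh; [lra|assumption|assumption].
Qed.

Lemma koenigs_derive_le (phi sigma : C -> C) (z : C) :
  0 < Cmod (C_derive phi (RtoC 0)) ->
  hyperbolic_contraction (Cmod (C_derive phi (RtoC 0))) phi ->
  is_koenigs phi sigma -> disk z ->
  (1 - Cmod z ^ 2) * Cmod (C_derive sigma z) <= 4.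
Proof.
set (lambda := C_derive phi (RtoC 0)); intros Hder0 Hphi Hsigma Hz.
assert (H0 := Cmod_ge_0 z); assert (Hz1 := Hz); unfold disk in Hz1.
(* Halfway between |z| and 1: the ball of radius (1 - |z|) / 2 about z lies in |w| <= r < 1. *)
set (r := (1 + Cmod z) / 2).
assert (Hr : 0 < 1 - r ^ 2) by (unfold r; nra).
apply Rle_trans with ((1 - Cmod z ^ 2) * / (1 - r ^ 2)).
(* With s = |z| the ratio is 4 (1 + s) / (3 + s), hence at most 4. *)
2: { apply (Rle_div_l _ _ _ Hr); unfold r; nra. }
apply Rmult_le_compat_l; [apply Rlt_le, one_minus_sqr_Cmod, Hz|].
apply Cmod_C_derive_le with ((1 - Cmod z) / 2); [lra|now apply Hsigma|].
intros y Hy.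
assert (Hyr : Cmod y <= r).
{ replace y with (z + (y - z))%C by ring.
  apply Rle_trans with (1 := Cmod_triangle _ _); unfold r; lra. }
assert (Hdisk : forall w, Cmod w <= r -> disk w)
  by (unfold disk, r; intros; lra).
(* On |w| <= r all approximants share the Lipschitz constant 1 / (1 - r^2), so pointwise convergence
   at y and z is enough. *)
apply (Cmod_lim_le _ _ _ (filterlim_Cminus _ _ _ _
  (proj2 Hsigma y (Hdisk y Hyr)) (proj2 Hsigma z Hz))); intros k.
assert (Hk := hyperbolic_contraction_iter _ _ k (Rlt_le _ _ Hder0) Hphi).
fold lambda; assert (Hc : 0 < Cmod lambda ^ k) by now apply pow_lt.
replace (Nat.iter k phi y / lambda ^ k - Nat.iter k phi z / lambda ^ k)%C
  with ((Nat.iter k phi y - Nat.iter k phi z) / lambda ^ k)%C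
  by (unfold Cdiv; ring).
rewrite Cmod_div_pow by assumption; apply Rle_div_l; [assumption|].
replace (/ (1 - r ^ 2) * Cmod (y - z) * Cmod lambda ^ k)
  with (Cmod lambda ^ k / (1 - r ^ 2) * Cmod (y - z)) by (field; lra).
destruct Hk as [[Hhol Hself] [_ Hk]].
apply Cmod_increment_le with r; try assumption; [| |unfold r; lra].
- intros w Hw; now apply Hhol, Hdisk.
- intros w Hw; apply Rle_div_r; [assumption|].
  apply Rle_trans with ((1 - Cmod w ^ 2) * Cmod (C_derive (Nat.iter k phi) w)).
  + rewrite Rmult_comm; apply Rmult_le_compat_r; [apply Cmod_ge_0|].
    generalize (Cmod_ge_0 w); nra.
  + apply Rle_trans with (1 := Hk w (Hdisk w Hw)).
    rewrite <- (Rmult_1_r (Cmod lambda ^ k)) at 2.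
    apply Rmult_le_compat_l; [lra|].
    apply one_minus_sqr_Cmod, Hself, Hdisk, Hw.
Qed.

(** * Bloch-type estimates and the conclusion *)

Lemma bloch_intro (alpha M : R) (f : C -> C) :
  holomorphic_on_disk f ->
  (forall z, disk z ->
     Rpower (1 - Cmod z ^ 2) alpha * Cmod (C_derive f z) <= M) ->
  bloch alpha f /\ real (Lub_Rbar (bloch_values alpha f)) <= M.
Proof.
intros Hf HM.
destruct (Lub_Rbar_correct (bloch_values alpha f)) as [Hub Hlub].
assert (HL : Rbar_le (Lub_Rbar (bloch_values alpha f)) M).
{ apply Hlub; intros y [z [Hz ->]]; exact (HM z Hz). }
(* The value at 0 makes the set nonempty. This excludes the supremum [m_infty], which [real] would
   turn into 0. *)
assert (H0 := Hub _ (ex_intro _ (RtoC 0) (conj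
  (ltac:(unfold disk; rewrite Cmod_0; lra) : disk (RtoC 0)) eq_refl))).
unfold bloch; destruct (Lub_Rbar _) as [l| |]; simpl in *; intuition.
Qed.

Lemma bloch_value_le (alpha : R) (f : C -> C) (z : C) :
  bloch alpha f -> disk z ->
  Rpower (1 - Cmod z ^ 2) alpha * Cmod (C_derive f z) <=
    real (Lub_Rbar (bloch_values alpha f)).
Proof.
intros [_ Hfin] Hz.
destruct (Lub_Rbar_correct (bloch_values alpha f)) as [Hub _].
specialize (Hub _ (ex_intro _ z (conj Hz eq_refl))).
destruct (Lub_Rbar _) as [l| |]; simpl in *; [assumption|easy|easy].
Qed.

Lemma Rpower_minus_1 (x a : R) : 0 < x -> Rpower x a = Rpower x (a - 1) * x.
Proof.
intros Hx; rewrite <- (Rpower_1 x Hx) at 3; rewrite <- Rpower_plus.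
f_equal; ring.
Qed.

(** Split off one factor 1 - |z|^2 for the contraction estimate; the remaining power alpha - 1 >= 0
    is monotone and uses |phi z| <= |z|. *)
Lemma comp_op_bounded_on_bloch (c alpha : R) (phi : C -> C) :
  0 <= c <= 1 -> 1 <= alpha -> hyperbolic_contraction c phi ->
  bounded_on_bloch alpha (comp_op phi).
Proof.
intros Hc Ha Hphi.
assert (H : forall f, bloch alpha f -> bloch alpha (comp_op phi f) /\
  real (Lub_Rbar (bloch_values alpha (comp_op phi f))) <=
  real (Lub_Rbar (bloch_values alpha f))).
{ intros f Hf; assert (Hmod := fun z => hyperbolic_contraction_Cmod_le c phi z Hc Hphi).
  destruct Hphi as [[Hhol Hself] [H0 Hphi]].
  assert (Hd := fun z (Hz : disk z) =>
    is_C_derive_comp f phi z (proj1 Hf _ (Hself z Hz)) (Hhol z Hz)).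
  apply bloch_intro.
  - intros z Hz; eexists; exact (Hd z Hz).
  - intros z Hz; apply Rle_trans with (2 := bloch_value_le _ f _ Hf (Hself z Hz)).
    rewrite (is_C_derive_unique (comp_op phi f) z _ (Hd z Hz)), Cmod_mult.
    rewrite <- Rmult_assoc; apply Rmult_le_compat_r; [apply Cmod_ge_0|].
    destruct (one_minus_sqr_Cmod z Hz) as [Hs _].
    destruct (one_minus_sqr_Cmod _ (Hself z Hz)) as [Hs' _].
    rewrite (Rpower_minus_1 _ alpha Hs), (Rpower_minus_1 _ alpha Hs'), Rmult_assoc.
    apply Rmult_le_compat.
    + apply Rlt_le, exp_pos.
    + apply Rmult_le_pos; [lra|apply Cmod_ge_0].
    + apply Rle_Rpower_l; [lra|split; [assumption|]].
      specialize (Hmod z Hz); generalize (Cmod_ge_0 (phi z)); nra.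
    + apply Rle_trans with (1 := Hphi z Hz); nra. }
split; [now intros f Hf; apply H|].
(* As phi fixes 0, the term |f 0| is unchanged, so the norm does not increase. *)
exists 1; intros f Hf; rewrite Rmult_1_l; unfold bloch_norm.
unfold comp_op at 1; rewrite (proj1 (proj2 Hphi)).
apply Rplus_le_compat_l, H, Hf.
Qed.

(** One factor 1 - |z|^2 controls the derivative of sigma; the remaining power alpha - 1 > 0 beats
    the logarithmic growth of sigma^(n-1). *)
Lemma koenigs_pow_bloch (phi sigma : C -> C) (alpha : R) (n : nat) :
  0 < Cmod (C_derive phi (RtoC 0)) ->
  hyperbolic_contraction (Cmod (C_derive phi (RtoC 0))) phi ->
  is_koenigs phi sigma -> 1 < alpha ->
  bloch alpha (fun z => sigma z ^ n)%C.
Proof.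
intros Hder0 Hphi Hsigma Ha.
destruct (Rpower_artanh_pow_bounded (alpha - 1) (pred n)) as [K HK]; [lra|].
assert (Hd := fun z (Hz : disk z) => is_C_derive_pow sigma z _ n
  (C_derive_correct sigma z z (proj1 Hsigma z Hz))).
(* [INR n] comes from the power rule, [K] from the growth of artanh, and 4 from
   [koenigs_derive_le]. *)
apply (bloch_intro alpha (INR n * (K * 4))).
- intros z Hz; eexists; exact (Hd z Hz).
- intros z Hz.
  rewrite (is_C_derive_unique (fun w => sigma w ^ n)%C z _ (Hd z Hz)).
  rewrite !Cmod_mult, Cmod_R, Rabs_pos_eq, Cmod_pow by apply pos_INR.
  destruct (one_minus_sqr_Cmod z Hz) as [Hs _].
  rewrite (Rpower_minus_1 _ alpha Hs).
  assert (H1 := koenigs_Cmod_le phi sigma z Hder0 Hphi Hsigma Hz).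
  assert (H2 := koenigs_derive_le phi sigma z Hder0 Hphi Hsigma Hz).
  set (p := Rpower (1 - Cmod z ^ 2) (alpha - 1)) in *.
  replace (p * (1 - Cmod z ^ 2) *
      (INR n * Cmod (sigma z) ^ pred n * Cmod (C_derive sigma z)))
    with (INR n * (p * Cmod (sigma z) ^ pred n *
      ((1 - Cmod z ^ 2) * Cmod (C_derive sigma z)))) by ring.
  assert (Hp : 0 <= p) by apply Rlt_le, exp_pos.
  apply Rmult_le_compat_l; [apply pos_INR|].
  apply Rmult_le_compat; [| |  |assumption].
  + apply Rmult_le_pos; [assumption|apply pow_le, Cmod_ge_0].
  + apply Rmult_le_pos; [lra|apply Cmod_ge_0].
  + apply Rle_trans with (p * artanh (Cmod z) ^ pred n).
    * apply Rmult_le_compat_l; [assumption|].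
      apply pow_incr; split; [apply Cmod_ge_0|assumption].
    * apply HK; split; [apply Cmod_ge_0|exact Hz].
Qed.

Theorem theorem3p3 (phi sigma : C -> C) (alpha : R)
  (Hphi : disk_self_map phi)
  (Hphi0 : phi (RtoC 0) = RtoC 0)
  (Hder0 : 0 < Cmod (C_derive phi (RtoC 0)) < 1)
  (Hsigma : is_koenigs phi sigma)
  (Halpha : 1 < alpha)
  (Hcontr : forall z : C, disk z ->
     (1 - Cmod z ^ 2) * Cmod (C_derive phi z) / (1 - Cmod (phi z) ^ 2)
       <= Cmod (C_derive phi (RtoC 0))) :
  bounded_on_bloch alpha (comp_op phi) /\
  forall n : nat, (0 < n)%nat ->
    bloch alpha (fun z : C => (sigma z ^ n)%C).
Proof.
assert (Hc : hyperbolic_contraction (Cmod (C_derive phi (RtoC 0))) phi).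
{ split; [assumption|split; [assumption|]]; intros z Hz.
  apply Rle_div_l, Hcontr, Hz.
  apply one_minus_sqr_Cmod, Hphi, Hz. }
split.
- apply comp_op_bounded_on_bloch with (2 := Rlt_le _ _ Halpha) (3 := Hc); lra.
- intros n _; now apply (koenigs_pow_bloch phi).
Qed.
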